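(* Let $\mathtt D$ be a description in reduced form over $(f_1,\dots,f_n,g_1,\dots,g_m)$. Suppose first that $\mathtt D$ contains no monotone symbol, and let $l=\lceil \mathrm{chr}(\mathtt D)/2\rceil$. If $m=0$ and $\mathrm{chr}(\mathtt D)$ is odd, then $\mathrm{Clo}(\mathtt D)\sim\mathcal A_l$; if $m=0$ and $\mathrm{chr}(\mathtt D)$ is even, then $\mathrm{Clo}(\mathtt D)\sim\mathcal B_l$; if $m>0$ and $\mathrm{chr}(\mathtt D)$ is even, then $\mathrm{Clo}(\mathtt D)\sim\mathcal C_{l+1}$; if $m>0$ and $\mathrm{chr}(\mathtt D)$ is odd, then $\mathrm{Clo}(\mathtt D)\sim\mathcal D_l$. Suppose now that $\mathtt D$ contains a monotone symbol. If $m=0$, then $\mathrm{Clo}(\mathtt D)\sim\mathcal B_\infty$; if $m>0$ and no $g_j$ is monotone, then $\mathrm{Clo}(\mathtt D)\sim\mathcal C_\infty$; if $m>0$ and some $g_j$ is monotone, then $\mathrm{Clo}(\mathtt D)\sim\mathcal D_\infty$.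
   Context: For $n$-ary Boolean operations $f,g$: $f\le g$ pointwise; $f\triangleleft g$ iff $f(\mathbf a)\le g(\mathbf b)$ whenever $\mathbf a\le\mathbf b$ componentwise; $f^d(\mathbf a)=1-f(\overline{\mathbf a})$ ($\overline{\mathbf a}$ coordinatewise negation). $\mathcal I_k$: all $k$-tuples of $n$-ary idempotent Boolean operations, $n\in\mathbb N$. A description over symbols $(h_1,\dots,h_k)$ is a set of constraints of the forms $h_i\triangleleft h_j$, $h_i\triangleleft h_j^d$, $h_i^d\triangleleft h_j$, $h_i^d\triangleleft h_j^d$, $h_i=h_j$, $h_i=h_j^d$, $h_i^d=h_j$, $h_i^d=h_j^d$; $\mathrm{Clo}(\mathtt D)$ is the set of $(h_1,\dots,h_k)\in\mathcal I_k$ satisfying all of them (a minion with componentwise minors). $\mathtt D$ is in reduced form if it is over $(f_1,\dots,f_n,g_1,\dots,g_m)$, $n+m\ge1$, with: $g_i=g_i^d\in\mathtt D$ for all $i$; all other constraints of the forms $f_i\triangleleft f_j$, $f_i\triangleleft f_j^d$, $f_i\triangleleft g_j$, $g_i\triangleleft g_i$; and no cycle $f_{i_1}\triangleleft f_{i_2}\triangleleft\dots\triangleleft f_{i_l}\triangleleft f_{i_1}$ in $\mathtt D$ with $l\ge2$ pairwise distinct indices. A symbol $f_i$ (resp. $g_i$) is monotone if $f_i\triangleleft f_i$ (resp. $g_i\triangleleft g_i$) is in $\mathtt D$. When no symbol is monotone: a path of length $l$ to $f_i$ is a sequence with $f_{i_1}\triangleleft f_{i_2},\dots,f_{i_{l-1}}\triangleleft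 f_{i_l}$ in $\mathtt D$ and $i_l=i$; $\mathrm{rank}(f_i)$ is the maximum length of a path to $f_i$; the chain rank $\mathrm{chr}(\mathtt D)$ is the maximum of the sets $\{\mathrm{rank}(f_i)\}$, $\{\mathrm{rank}(f_i)+\mathrm{rank}(f_j): f_i\triangleleft f_j^d\in\mathtt D\}$, and $\{2\,\mathrm{rank}(f_i)+1: f_i\triangleleft g_j\in\mathtt D\text{ for some }j\}$. Minions (chains mean consecutive relations hold): $\mathcal A_k=\{\mathbf h\in\mathcal I_k: h_1\triangleleft\dots\triangleleft h_k\le h_k^d\}$; $\mathcal B_k=\{\mathbf h\in\mathcal I_k: h_1\triangleleft\dots\triangleleft h_k\triangleleft h_k^d\}$; $\mathcal C_k=\{\mathbf h\in\mathcal I_k: h_1\triangleleft\dots\triangleleft h_{k-1}\le h_k=h_k^d,\ h_{k-1}\triangleleft h_{k-1}^d\}$; $\mathcal D_k=\{\mathbf h\in\mathcal I_k: h_1\triangleleft\dots\triangleleft h_k=h_k^d\}$; $\mathcal B_\infty=\{(h)\in\mathcal I_1: h\triangleleft h\triangleleft h^d\}$; $\mathcal C_\infty=\{(h_1,h_2)\in\mathcal I_2: h_1\triangleleft h_1\triangleleft h_2=h_2^d\}$; $\mathcal D_\infty=\{(h)\in\mathcal I_1: h\triangleleft h=h^d\}$. ($\mathcal C_1$ is read as $\{(h)\in\mathcal I_1:h=h^d\}=\mathcal D_1$.) $\sim$ means minion homomorphisms (arity-preserving, minor-commuting maps) exist in both directions. *)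

(* Defs.v *)
From mathcomp Require Import all_boot.

Set Implicit Arguments.
Unset Strict Implicit.
Unset Printing Implicit Defensive.

Definition op (n : nat) := {ffun {ffun 'I_n -> bool} -> bool}.

Definition pt_le n (a b : {ffun 'I_n -> bool}) : Prop :=
  forall i, a i ==> b i.

Definition op_le n (f g : op n) : Prop := forall a, f a ==> g a.

Definition op_tri n (f g : op n) : Prop :=
  forall a b, pt_le a b -> f a ==> g b.

Definition dual n (f : op n) : op n :=
  [ffun a : {ffun 'I_n -> bool} => ~~ f [ffun i => ~~ a i]].

(* No operation of arity 0 is idempotent in this sense, so allowing n = 0
   below only adds an empty component to every minion. *)
Definition idempotent n (f : op n) : Prop :=
  forall x : bool, f [ffun => x] = x.

Definition op_minor n n' (pi : 'I_n -> 'I_n') (f : op n) : op n' :=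
  [ffun a : {ffun 'I_n' -> bool} => f [ffun i => a (pi i)]].

Definition optuple (k n : nat) := {ffun 'I_k -> op n}.

Definition minor k n n' (pi : 'I_n -> 'I_n') (h : optuple k n)
  : optuple k n' := [ffun i => op_minor pi (h i)].

Definition in_I k n (h : optuple k n) : Prop := forall i, idempotent (h i).

Record minion (k : nat) := Minion {
  mem_minion : forall n, optuple k n -> Prop;
  minion_idem : forall n (h : optuple k n), mem_minion h -> in_I h;
  minion_minor : forall n n' (pi : 'I_n -> 'I_n') (h : optuple k n),
    mem_minion h -> mem_minion (minor pi h)
}.

(* phi is total on optuple k n, but only its restriction to M matters; as
   optuple k' n is never empty, any map defined on M extends to such a phi. *)
Definition minion_hom k k' (M : minion k) (N : minion k')
    (phi : forall n, optuple k n -> optuple k' n) : Prop :=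
  (forall n (h : optuple k n), mem_minion M h -> mem_minion N (phi n h)) /\
  (forall n n' (pi : 'I_n -> 'I_n') (h : optuple k n), mem_minion M h ->
     phi n' (minor pi h) = minor pi (phi n h)).

Definition minion_equiv k k' (M : minion k) (N : minion k') : Prop :=
  (exists phi, minion_hom M N phi) /\ (exists psi, minion_hom N M psi).

Section MinorLemmas.
Variables (n n' : nat) (pi : 'I_n -> 'I_n').

Lemma dual_minor (f : op n) : dual (op_minor pi f) = op_minor pi (dual f).
Proof.
apply/ffunP => a; rewrite !ffunE; congr (~~ f _).
by apply/ffunP => i; rewrite !ffunE.
Qed.

Lemma op_le_minor (f g : op n) :
  op_le f g -> op_le (op_minor pi f) (op_minor pi g).
Proof. by move=> fg a; rewrite !ffunE; apply: fg. Qed.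

Lemma op_tri_minor (f g : op n) :
  op_tri f g -> op_tri (op_minor pi f) (op_minor pi g).
Proof.
by move=> fg a b ab; rewrite !ffunE; apply: fg => i; rewrite !ffunE; apply: ab.
Qed.

Lemma idempotent_minor (f : op n) : idempotent f -> idempotent (op_minor pi f).
Proof.
move=> idf x; rewrite ffunE -[RHS]idf; congr (f _).
by apply/ffunP => i; rewrite !ffunE.
Qed.

Lemma in_I_minor k (h : optuple k n) : in_I h -> in_I (minor pi h).
Proof. by move=> Ih i; rewrite ffunE; apply: idempotent_minor. Qed.

End MinorLemmas.

(* (i, false) stands for h_i and (i, true) for h_i^d. *)
Definition literal (k : nat) := ('I_k * bool)%type.

Definition sym k (i : 'I_k) : literal k := (i, false).
Definition dsym k (i : 'I_k) : literal k := (i, true).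

(* The left summand holds the constraints x <| y (written ctri x y), the right
   one the constraints x = y (written ceq x y). *)
Definition constraint (k : nat) :=
  (literal k * literal k + literal k * literal k)%type.

Definition ctri k (x y : literal k) : constraint k := inl (x, y).
Definition ceq k (x y : literal k) : constraint k := inr (x, y).

Definition description (k : nat) := {set constraint k}.

Definition lit_val k n (h : optuple k n) (x : literal k) : op n :=
  if x.2 then dual (h x.1) else h x.1.

Definition satisfies k n (h : optuple k n) (c : constraint k) : Prop :=
  match c with
  | inl (x, y) => op_tri (lit_val h x) (lit_val h y)
  | inr (x, y) => lit_val h x = lit_val h y
  end.

Definition in_Clo k (D : description k) n (h : optuple k n) : Prop :=
  in_I h /\ (forall c, c \in D -> satisfies h c).

Lemma lit_val_minor k n n' (pi : 'I_n -> 'I_n') (h : optuple k n) x :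
  lit_val (minor pi h) x = op_minor pi (lit_val h x).
Proof. by rewrite /lit_val ffunE dual_minor; case: x.2. Qed.

Lemma in_Clo_minor k (D : description k) n n' (pi : 'I_n -> 'I_n')
  (h : optuple k n) : in_Clo D h -> in_Clo D (minor pi h).
Proof.
case=> Ih sat; split; first exact: in_I_minor.
move=> c /sat; case: c => [] [x y] /=; rewrite !lit_val_minor.
  exact: op_tri_minor.
by move=> ->.
Qed.

Definition Clo k (D : description k) : minion k :=
  Minion (fun n h => @proj1 _ _ : @in_Clo k D n h -> in_I h)
         (@in_Clo_minor k D).

(* The symbols (f_1,...,f_n,g_1,...,g_m) are the elements of 'I_(n + m) in
   this order: fs m i is f_(i+1) and gs n j is g_(j+1). *)

Definition fs n m (i : 'I_n) : 'I_(n + m) := lshift m i.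
Definition gs n m (j : 'I_m) : 'I_(n + m) := rshift n j.
Arguments fs {n} m i.
Arguments gs n {m} j.

Definition fedge n m (D : description (n + m)) : rel 'I_n :=
  [rel i j | ctri (sym (fs m i)) (sym (fs m j)) \in D].

Inductive reduced_constraint n m : constraint (n + m) -> Prop :=
| RedSelfDual j :
    reduced_constraint (ceq (sym (gs n j)) (dsym (gs n j)))
| RedFF i j :
    reduced_constraint (ctri (sym (fs m i)) (sym (fs m j)))
| RedFFd i j :
    reduced_constraint (ctri (sym (fs m i)) (dsym (fs m j)))
| RedFG i j :
    reduced_constraint (ctri (sym (fs m i)) (sym (gs n j)))
| RedGG j :
    reduced_constraint (ctri (sym (gs n j)) (sym (gs n j))).

Definition reduced n m (D : description (n + m)) : Prop :=
  [/\ 0 < n + m,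
      forall j : 'I_m, ceq (sym (gs n j)) (dsym (gs n j)) \in D,
      forall c, c \in D -> reduced_constraint c
    & forall s : seq 'I_n, 2 <= size s -> uniq s -> ~~ cycle (fedge D) s].

Definition monotone k (D : description k) (s : 'I_k) : bool :=
  ctri (sym s) (sym s) \in D.

(* The length of a path is its number of vertices, size s. *)
Definition path_to n m (D : description (n + m)) (i : 'I_n) (s : seq 'I_n)
  : bool := [&& s != [::], sorted (fedge D) s & last i s == i].

(* The bound l <= n loses nothing when D is in reduced form without monotone
   symbols, as paths then have no repeated vertex: see rankP. *)
Definition rank n m (D : description (n + m)) (i : 'I_n) : nat :=
  \max_(l < n.+1 | [exists s : l.-tuple 'I_n, path_to D i s]) l.

(* Maxima over empty sets are 0; in particular chr D = 0 when n = 0. *)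
Definition chr n m (D : description (n + m)) : nat :=
  maxn (\max_(i < n) rank D i)
  (maxn (\max_(i < n) \max_(j < n | ctri (sym (fs m i)) (dsym (fs m j)) \in D)
           (rank D i + rank D j))
        (\max_(i < n | [exists j : 'I_m, ctri (sym (fs m i)) (sym (gs n j)) \in D])
           (2 * rank D i + 1))).

Lemma path_uniq n m (D : description (n + m)) (s : seq 'I_n) :
  reduced D -> (forall x, ~~ monotone D x) ->
  sorted (fedge D) s -> uniq s.
Proof.
case=> _ _ _ acyc nomon; elim: s => //= x p IHp xp.
have Up : uniq p by apply: IHp; apply: path_sorted xp.
rewrite Up andbT; apply/negP => /splitPr px.
case: px xp Up {IHp} => p1 p2; rewrite cat_path /= => /and3P[xp1 ex _].
rewrite cat_uniq /= => /and3P[Up1 /norP[xNp1 _] _].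
have cyc : cycle (fedge D) (x :: p1) by rewrite /= rcons_path xp1.
case: p1 => [|y p1] in xp1 ex Up1 xNp1 cyc *.
  by move: cyc; rewrite /= andbT; apply/negP; apply: nomon.
by apply: (negP (acyc (x :: y :: p1) isT _)) cyc; rewrite cons_uniq xNp1.
Qed.

Lemma rankP n m (D : description (n + m)) (i : 'I_n) :
  reduced D -> (forall x, ~~ monotone D x) ->
  (exists2 s, path_to D i s & size s = rank D i) /\
  (forall s, path_to D i s -> size s <= rank D i).
Proof.
move=> redD nomon; split; last first.
  move=> s ps; have /and3P[_ /(path_uniq redD nomon) Us _] := ps.
  have ltsn : size s < n.+1.
    rewrite ltnS -(card_uniqP Us) -[n in leqRHS]card_ord.
    exact: max_card.
  apply: (leq_bigmax_cond (F := fun l : 'I_n.+1 => l : nat) (Ordinal ltsn)).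
  by apply/existsP; exists (in_tuple s).
have lt1n : 1 < n.+1 by rewrite ltnS (leq_ltn_trans _ (ltn_ord i)).
pose P (l : 'I_n.+1) := [exists s : l.-tuple 'I_n, path_to D i s].
have P1 : P (Ordinal lt1n).
  by apply/existsP; exists [tuple i]; rewrite /path_to /= eqxx.
have [l Pl maxl] :
    {l | P l & \max_(l < n.+1 | P l) l = l}.
  by apply: eq_bigmax_cond; apply/card_gt0P; exists (Ordinal lt1n).
have /existsP[s ps] := Pl.
by exists s => //; rewrite size_tuple /rank maxl.
Qed.

(* Indices are 0-based: h_i is the entry of
   value i - 1, so that i.+1 = k singles out h_k and i.+2 = k singles out
   h_(k-1). *)

Definition in_A k n (h : optuple k n) : Prop :=
  [/\ in_I h,
      forall i j : 'I_k, i.+1 = j -> op_tri (h i) (h j)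
    & forall i : 'I_k, i.+1 = k -> op_le (h i) (dual (h i))].

Definition in_B k n (h : optuple k n) : Prop :=
  [/\ in_I h,
      forall i j : 'I_k, i.+1 = j -> op_tri (h i) (h j)
    & forall i : 'I_k, i.+1 = k -> op_tri (h i) (dual (h i))].

(* For k = 1 only the constraint h = h^d remains. *)
Definition in_C k n (h : optuple k n) : Prop :=
  [/\ in_I h,
      forall i j : 'I_k, i.+1 = j -> j.+1 < k -> op_tri (h i) (h j),
      forall i j : 'I_k, i.+1 = j -> j.+1 = k -> op_le (h i) (h j),
      forall i : 'I_k, i.+1 = k -> h i = dual (h i)
    & forall i : 'I_k, i.+2 = k -> op_tri (h i) (dual (h i))].

Definition in_D k n (h : optuple k n) : Prop :=
  [/\ in_I h,
      forall i j : 'I_k, i.+1 = j -> op_tri (h i) (h j)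
    & forall i : 'I_k, i.+1 = k -> h i = dual (h i)].

Definition in_Binf n (h : optuple 1 n) : Prop :=
  [/\ in_I h, op_tri (h ord0) (h ord0) & op_tri (h ord0) (dual (h ord0))].

Definition in_Cinf n (h : optuple 2 n) : Prop :=
  [/\ in_I h, op_tri (h ord0) (h ord0), op_tri (h ord0) (h ord_max)
    & h ord_max = dual (h ord_max)].

Definition in_Dinf n (h : optuple 1 n) : Prop :=
  [/\ in_I h, op_tri (h ord0) (h ord0) & h ord0 = dual (h ord0)].

Section Closure.
Variables (n n' : nat) (pi : 'I_n -> 'I_n').

Lemma in_A_minor k (h : optuple k n) : in_A h -> in_A (minor pi h).
Proof.
case=> Ih H1 H2; split=> [|i j ij|i ik]; first exact: in_I_minor.
  by rewrite !ffunE; apply: op_tri_minor; apply: H1.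
by rewrite !ffunE dual_minor; apply: op_le_minor; apply: H2.
Qed.

Lemma in_B_minor k (h : optuple k n) : in_B h -> in_B (minor pi h).
Proof.
case=> Ih H1 H2; split=> [|i j ij|i ik]; first exact: in_I_minor.
  by rewrite !ffunE; apply: op_tri_minor; apply: H1.
by rewrite !ffunE dual_minor; apply: op_tri_minor; apply: H2.
Qed.

Lemma in_C_minor k (h : optuple k n) : in_C h -> in_C (minor pi h).
Proof.
case=> Ih H1 H2 H3 H4; split=> [|i j ij jk|i j ij jk|i ik|i ik].
- exact: in_I_minor.
- by rewrite !ffunE; apply: op_tri_minor; apply: H1.
- by rewrite !ffunE; apply: op_le_minor; apply: H2.
- by rewrite !ffunE dual_minor -H3.
- by rewrite !ffunE dual_minor; apply: op_tri_minor; apply: H4.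
Qed.

Lemma in_D_minor k (h : optuple k n) : in_D h -> in_D (minor pi h).
Proof.
case=> Ih H1 H2; split=> [|i j ij|i ik]; first exact: in_I_minor.
  by rewrite !ffunE; apply: op_tri_minor; apply: H1.
by rewrite !ffunE dual_minor -H2.
Qed.

Lemma in_Binf_minor (h : optuple 1 n) : in_Binf h -> in_Binf (minor pi h).
Proof.
case=> Ih H1 H2; split; first exact: in_I_minor.
  by rewrite !ffunE; apply: op_tri_minor.
by rewrite !ffunE dual_minor; apply: op_tri_minor.
Qed.

Lemma in_Cinf_minor (h : optuple 2 n) : in_Cinf h -> in_Cinf (minor pi h).
Proof.
case=> Ih H1 H2 H3; split; first exact: in_I_minor.
- by rewrite !ffunE; apply: op_tri_minor.
- by rewrite !ffunE; apply: op_tri_minor.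
- by rewrite !ffunE dual_minor -H3.
Qed.

Lemma in_Dinf_minor (h : optuple 1 n) : in_Dinf h -> in_Dinf (minor pi h).
Proof.
case=> Ih H1 H2; split; first exact: in_I_minor.
  by rewrite !ffunE; apply: op_tri_minor.
by rewrite !ffunE dual_minor -H2.
Qed.

End Closure.

Lemma in_A_I k n (h : optuple k n) : in_A h -> in_I h. Proof. by case. Qed.
Lemma in_B_I k n (h : optuple k n) : in_B h -> in_I h. Proof. by case. Qed.
Lemma in_C_I k n (h : optuple k n) : in_C h -> in_I h. Proof. by case. Qed.
Lemma in_D_I k n (h : optuple k n) : in_D h -> in_I h. Proof. by case. Qed.
Lemma in_Binf_I n (h : optuple 1 n) : in_Binf h -> in_I h. Proof. by case. Qed.
Lemma in_Cinf_I n (h : optuple 2 n) : in_Cinf h -> in_I h. Proof. by case. Qed.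
Lemma in_Dinf_I n (h : optuple 1 n) : in_Dinf h -> in_I h. Proof. by case. Qed.

Definition minionA k : minion k :=
  Minion (@in_A_I k) (fun n n' pi => @in_A_minor n n' pi k).
Definition minionB k : minion k :=
  Minion (@in_B_I k) (fun n n' pi => @in_B_minor n n' pi k).
Definition minionC k : minion k :=
  Minion (@in_C_I k) (fun n n' pi => @in_C_minor n n' pi k).
Definition minionD k : minion k :=
  Minion (@in_D_I k) (fun n n' pi => @in_D_minor n n' pi k).
Definition minionBinf : minion 1 := Minion in_Binf_I in_Binf_minor.
Definition minionCinf : minion 2 := Minion in_Cinf_I in_Cinf_minor.
Definition minionDinf : minion 1 := Minion in_Dinf_I in_Dinf_minor.

(* Main.v *)
Require Import Defs.
From mathcomp Require Import all_boot zify.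

(** Let c be the chain rank and l = ceil(c/2). A tuple h_1 <| ... <| h_l of the
    target minion unfolds to a chain h_1 <| ... <| h_l <| ... <| h_1^d of length
    c, and sending f_i to its entry number rank(f_i), and each g_j to the last
    component of the tuple, satisfies D. Conversely, D entails a chain
    e_1 <| ... <| e_c of symbols and duals: if c comes from f_i <| f_j^d,
    follow a longest path to f_i by the dual of one to f_j; if it comes from
    f_i <| g_j, use f_i <| g_j = g_j^d <| f_i^d instead. This chain folds to
    p_r = e_r /\ e_(c+1-r)^d, r <= l. A self-dual operation above p <= p^d is
    (g_j \/ p) /\ p^d. If a symbol f is monotone, p = f /\ f^d satisfies
    p <| p <| p^d and plays the role of the folded chain. *)

Set Implicit Arguments.
Unset Strict Implicit.
Unset Printing Implicit Defensive.

(** * Lattice operations, duality and the relation <| on Boolean operations *)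

Section Operations.
Variable N : nat.
Implicit Types f g h p : op N.

Definition op_meet f g : op N :=
  [ffun a : {ffun 'I_N -> bool} => f a && g a].

Definition op_join f g : op N :=
  [ffun a : {ffun 'I_N -> bool} => f a || g a].

Lemma op_le_refl f : op_le f f.
Proof. by move=> a; apply/implyP. Qed.

Lemma op_le_trans f g h : op_le f g -> op_le g h -> op_le f h.
Proof. by move=> fg gh a; move: (fg a) (gh a); do 3 case: (_ a). Qed.

Lemma op_tri_le f g : op_tri f g -> op_le f g.
Proof. by move=> fg a; apply: fg => i; apply/implyP. Qed.

Lemma op_le_tri_trans f g h : op_le f g -> op_tri g h -> op_tri f h.
Proof.
by move=> fg gh a b ab; move: (fg a) (gh a b ab); do 2 case: (_ a).
Qed.

Lemma op_tri_le_trans f g h : op_tri f g -> op_le g h -> op_tri f h.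
Proof.
move=> fg gh a b ab; apply/implyP => fa.
by apply: (implyP (gh b)); apply: (implyP (fg a b ab)).
Qed.

Lemma op_tri_trans f g h : op_tri f g -> op_tri g h -> op_tri f h.
Proof. by move=> /op_tri_le; apply: op_le_tri_trans. Qed.

Lemma dualK f : dual (dual f) = f.
Proof.
apply/ffunP => a; rewrite !ffunE negbK; congr (f _).
by apply/ffunP => i; rewrite !ffunE negbK.
Qed.

Lemma dual_le f g : op_le f g -> op_le (dual g) (dual f).
Proof. by move=> fg a; rewrite !ffunE implybNN. Qed.

Lemma dual_tri f g : op_tri f g -> op_tri (dual g) (dual f).
Proof.
move=> fg a b ab; rewrite !ffunE implybNN; apply: fg => i.
by rewrite !ffunE implybNN.
Qed.

Lemma op_tri_dual f g : op_tri f (dual g) -> op_tri g (dual f).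
Proof. by move/dual_tri; rewrite dualK. Qed.

Lemma dual_meet f g : dual (op_meet f g) = op_join (dual f) (dual g).
Proof. by apply/ffunP => a; rewrite !ffunE negb_and. Qed.

Lemma dual_join f g : dual (op_join f g) = op_meet (dual f) (dual g).
Proof. by apply/ffunP => a; rewrite !ffunE negb_or. Qed.

Lemma op_joinC f g : op_join f g = op_join g f.
Proof. by apply/ffunP => a; rewrite !ffunE orbC. Qed.

Lemma op_meet_le f g : op_le (op_meet f g) f.
Proof. by move=> a; rewrite !ffunE; do 2 case: (_ a). Qed.

Lemma op_le_join f g : op_le f (op_join f g).
Proof. by move=> a; rewrite !ffunE; do 2 case: (_ a). Qed.

Lemma op_tri_meet f g f' g' :
  op_tri f f' -> op_tri g g' -> op_tri (op_meet f g) (op_meet f' g').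
Proof.
move=> ff gg a b ab; rewrite !ffunE.
by move: (ff a b ab) (gg a b ab); do 2 case: (_ a) => //=; case: (_ b).
Qed.

(** The dual of f /\ g^d is g \/ f^d, so the step from one to the other passes through f and then g.
    The next lemma repeats this with <|. *)
Lemma meet_dual_le f g : op_le f g ->
  op_le (op_meet f (dual g)) (dual (op_meet f (dual g))).
Proof.
move=> fg; rewrite dual_meet dualK op_joinC.
apply: op_le_trans (op_meet_le _ _) _; apply: op_le_trans fg _.
exact: op_le_join.
Qed.

Lemma meet_dual_tri f g : op_tri f g ->
  op_tri (op_meet f (dual g)) (dual (op_meet f (dual g))).
Proof.
move=> fg; rewrite dual_meet dualK op_joinC.
apply: op_le_tri_trans (op_meet_le _ _) _; apply: op_tri_le_trans fg _.
exact: op_le_join.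
Qed.

(** For p <= p^d this is g truncated to the interval from p to p^d, that is, the majority of g, p
    and p^d. *)
Definition op_clamp g p : op N := op_meet (op_join g p) (dual p).

(** Duality turns (g \/ p) /\ p^d into (g /\ p^d) \/ p; the two agree by the modular law, since p <=
    p^d. *)
Lemma op_clamp_selfdual g p :
  g = dual g -> op_le p (dual p) -> op_clamp g p = dual (op_clamp g p).
Proof.
move=> gd pp; rewrite /op_clamp dual_meet dual_join dualK -gd.
apply/ffunP => a; move: (pp a); rewrite [LHS]ffunE [RHS]ffunE.
rewrite [op_join _ _ a]ffunE [op_meet _ _ a]ffunE.
by case: (p a); case: (dual p a); case: (g a).
Qed.

Lemma le_op_clamp g p : op_le p (dual p) -> op_le p (op_clamp g p).
Proof.
move=> pp a; move: (pp a); rewrite [op_clamp _ _ _]ffunE [op_join _ _ a]ffunE.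
by case: (p a); case: (dual p a); case: (g a).
Qed.

End Operations.

(** * Minion homomorphisms given by terms *)

(* Operations obtained by terms in dual, meet and join commute with minors, so
   a tuple of terms satisfying the constraints is a minion homomorphism. *)
Inductive term (k : nat) :=
  | Var of 'I_k
  | Dual of term k
  | Meet of term k & term k
  | Join of term k & term k.

Fixpoint eval k N (h : optuple k N) (t : term k) : op N :=
  match t with
  | Var i => h i
  | Dual t => dual (eval h t)
  | Meet t u => op_meet (eval h t) (eval h u)
  | Join t u => op_join (eval h t) (eval h u)
  end.

Lemma eval_minor k N N' (pi : 'I_N -> 'I_N') (h : optuple k N) t :
  eval (minor pi h) t = op_minor pi (eval h t).
Proof.
elim: t => [i|t /= ->|t /= -> u ->|t /= -> u ->] /=.
- by rewrite ffunE.
- by rewrite dual_minor.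
- by apply/ffunP => a; rewrite !ffunE.
- by apply/ffunP => a; rewrite !ffunE.
Qed.

Lemma dual_idempotent N (f : op N) : Defs.idempotent f -> Defs.idempotent (dual f).
Proof.
move=> If x; rewrite ffunE -[RHS]negbK -[~~ x]If; congr (~~ f _).
by apply/ffunP => i; rewrite !ffunE.
Qed.

Lemma eval_idempotent k N (h : optuple k N) t :
  in_I h -> Defs.idempotent (eval h t).
Proof.
move=> Ih; elim: t => [i|t It|t It u Iu|t It u Iu] /=.
- exact: Ih.
- exact: dual_idempotent.
- by move=> x; rewrite ffunE It Iu andbb.
- by move=> x; rewrite ffunE It Iu orbb.
Qed.

Definition eval_tuple k k' N (t : 'I_k' -> term k) (h : optuple k N) :
  optuple k' N := [ffun i => eval h (t i)].

Lemma in_I_eval_tuple k k' N (t : 'I_k' -> term k) (h : optuple k N) :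
  in_I h -> in_I (eval_tuple t h).
Proof. by move=> Ih i; rewrite ffunE; apply: eval_idempotent. Qed.

Lemma term_hom k k' (M : minion k) (M' : minion k') (t : 'I_k' -> term k) :
  (forall N (h : optuple k N), mem_minion M h ->
     mem_minion M' (eval_tuple t h)) ->
  exists phi, minion_hom M M' phi.
Proof.
move=> tP; exists (fun N => @eval_tuple k k' N t); split=> // N N' pi h _.
by apply/ffunP => i; rewrite !ffunE eval_minor.
Qed.

(** * Homomorphisms into [Clo D] and chains entailed by [D] *)

Section Reduced.
Variables (n m : nat) (D : description (n + m)).
Hypothesis redD : reduced D.

(** One term [u] can serve every g_j, because reduced constraints never relate two different g's.
    The conditions on [u] are quantified over [j : 'I_m], so they are void when m = 0. *)
Lemma hom_to_Clo k (M : minion k) (t : 'I_n -> term k) (u : term k) :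
  (forall N (h : optuple k N), mem_minion M h ->
    [/\ forall i j, fedge D i j -> op_tri (eval h (t i)) (eval h (t j)),
        forall i j, ctri (sym (fs m i)) (dsym (fs m j)) \in D ->
          op_tri (eval h (t i)) (dual (eval h (t j))),
        forall j : 'I_m, eval h u = dual (eval h u),
        forall i (j : 'I_m), ctri (sym (fs m i)) (sym (gs n j)) \in D ->
          op_tri (eval h (t i)) (eval h u)
      & forall j : 'I_m, monotone D (gs n j) ->
          op_tri (eval h u) (eval h u)]) ->
  exists phi, minion_hom M (Clo D) phi.
Proof.
move=> tP; pose v (x : 'I_(n + m)) := if split x is inl i then t i else u.
have vf i : v (fs m i) = t i by rewrite /v (unsplitK (inl i)).
have vg j : v (gs n j) = u by rewrite /v (unsplitK (inr j)).
apply: (@term_hom _ _ _ _ v) => N h Mh; have [ff ffd gg fg mg] := tP N h Mh.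
split; first exact: in_I_eval_tuple (minion_idem Mh).
move=> c cD; have [_ _ /(_ c cD) redc _] := redD.
by case: redc cD => [j|i j|i j|i j|j] cD; rewrite /= /lit_val /= !ffunE ?vf ?vg;
  eauto.
Qed.

Lemma selfdual_gs N (h : optuple (n + m) N) j :
  in_Clo D h -> h (gs n j) = dual (h (gs n j)).
Proof. by have [_ /(_ j) gD _ _] := redD; case=> _ /(_ _ gD). Qed.

Definition neg_lit k (x : literal k) : literal k := (x.1, ~~ x.2).

Lemma lit_val_neg k N (h : optuple k N) x :
  lit_val h (neg_lit x) = dual (lit_val h x).
Proof. by rewrite /lit_val /=; case: x => i [] //=; rewrite dualK. Qed.

(* The third disjunct is y^d <| x = x^d, hence x <| y. *)
Definition derives : rel (literal (n + m)) :=
  [rel x y | [|| ctri x y \in D, ctri (neg_lit y) (neg_lit x) \in D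
    | (ceq x (neg_lit x) \in D) && (ctri (neg_lit y) x \in D)]].

Lemma derives_sound x y N (h : optuple (n + m) N) :
  derives x y -> in_Clo D h -> op_tri (lit_val h x) (lit_val h y).
Proof.
move=> xy [_ sat]; case/or3P: xy => [/sat //|/sat|/andP[/sat e /sat]] /=.
  by move/dual_tri; rewrite -!lit_val_neg; case: x y => [? []] [? []].
rewrite {1}[lit_val h x]e !lit_val_neg => /dual_tri.
by rewrite !dualK.
Qed.

Lemma sorted_map_sym s :
  sorted (fedge D) s -> sorted derives [seq sym (fs m i) | i <- s].
Proof.
rewrite sorted_map; apply: sub_sorted => i j ij.
by apply/or3P; apply: Or31.
Qed.

Lemma sorted_rev_map_dsym s :
  sorted (fedge D) s -> sorted derives (rev [seq dsym (fs m i) | i <- s]).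
Proof.
rewrite rev_sorted sorted_map; apply: sub_sorted => i j ij.
by apply/or3P; apply: Or32.
Qed.

Hypothesis nomon : forall x, ~~ monotone D x.

Lemma rank_path i : exists s,
  sorted (fedge D) (rcons s i) /\ (size s).+1 = rank D i.
Proof.
have [[s /and3P[s0 ss /eqP si] sz] _] := rankP i redD nomon.
case/lastP: s s0 ss si sz => // s x _; rewrite last_rcons size_rcons.
by move=> ss <- sz; exists s.
Qed.

Lemma rank_gt0 i : 0 < rank D i.
Proof. by have [s [_ <-]] := rank_path i. Qed.

(** A longest path to [i] followed by [j] is a path to [j]. *)
Lemma rank_edge i j : fedge D i j -> rank D i < rank D j.
Proof.
move=> ij; have [s [ss <-]] := rank_path i; have [_ maxj] := rankP j redD nomon.
rewrite -(size_rcons s i) -(size_rcons _ j); apply: maxj; apply/and3P; split.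
- by case: s {ss}.
- by rewrite -cats1 cat_rcons sorted_cat_cons ss /= ij.
- by rewrite last_rcons.
Qed.

Lemma rank_le_chr i : rank D i <= chr D.
Proof. by rewrite leq_max (leq_bigmax (F := rank D)). Qed.

Lemma rank_dual_le_chr i j :
  ctri (sym (fs m i)) (dsym (fs m j)) \in D -> rank D i + rank D j <= chr D.
Proof.
move=> ij; rewrite /chr !leq_max; apply/or3P; apply: Or32.
rewrite (leq_trans _ (leq_bigmax i)) //=.
exact: (leq_bigmax_cond (F := fun j => rank D i + rank D j)).
Qed.

Lemma rank_selfdual_le_chr i (j : 'I_m) :
  ctri (sym (fs m i)) (sym (gs n j)) \in D -> (rank D i).*2.+1 <= chr D.
Proof.
move=> ij; rewrite /chr !leq_max; apply/or3P; apply: Or33.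
rewrite -mul2n -addn1.
apply: (leq_bigmax_cond (F := fun i => 2 * rank D i + 1)).
by apply/existsP; exists j.
Qed.

Lemma chr_chain : exists2 c, sorted derives c & size c = chr D.
Proof.
(* [P v] says that some chain has length [v]. It holds at 0 and passes to maxima, so each single
   term of the maxima defining [chr] can be treated separately. *)
pose P v := exists2 c, sorted derives c & size c = v.
have P0 : P 0 by exists [::].
have Pmax a b : P a -> P b -> P (maxn a b) by rewrite /maxn; case: ifP.
(* A longest path to f_i is a chain ending in f_i; in [down] it is reversed and dualized into one
   starting with f_i^d. *)
have up i : exists c, sorted derives (rcons c (sym (fs m i)))
    /\ (size c).+1 = rank D i.
  have [s [ss sz]] := rank_path i; exists [seq sym (fs m i) | i <- s].
  by rewrite -map_rcons size_map; split=> //; apply: sorted_map_sym.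
have down i : exists c, sorted derives (dsym (fs m i) :: c)
    /\ (size c).+1 = rank D i.
  have [s [ss sz]] := rank_path i; exists (rev [seq dsym (fs m i) | i <- s]).
  rewrite -rev_rcons -map_rcons size_rev size_map; split=> //.
  exact: sorted_rev_map_dsym.
apply: (Pmax _ _ _ (Pmax _ _ _ _)); apply: (big_ind P) => // i.
- have [c [cs <-]] := up i.
  by exists (rcons c (sym (fs m i))); rewrite ?size_rcons.
- move=> _; apply: (big_ind P) => // j ij.
  have [[c [cs <-]] [d [ds <-]]] := (up i, down j).
  exists (c ++ sym (fs m i) :: dsym (fs m j) :: d); last first.
    by rewrite size_cat /= addnS addSn.
  have ffd : derives (sym (fs m i)) (dsym (fs m j)) by apply/or3P; apply: Or31.
  by rewrite sorted_cat_cons cs /path ffd.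
- case/existsP => j ij; have [_ /(_ j) gd _ _] := redD.
  have [[c [cs cz]] [d [ds dz]]] := (up i, down i).
  (* The symbol g_j sits between the two halves and accounts for the summand 1 in 2 rank(f_i) +
     1. *)
  exists (c ++ [:: sym (fs m i), sym (gs n j), dsym (fs m i) & d]).
    have gfd : derives (sym (gs n j)) (dsym (fs m i)).
      by apply/or3P; apply: Or33; rewrite gd.
    have fg : derives (sym (fs m i)) (sym (gs n j)) by apply/or3P; apply: Or31.
    by rewrite sorted_cat_cons cs /path fg gfd.
  by rewrite size_cat /=; lia.
Qed.

End Reduced.

(** * Folding and unfolding of chains *)

(** The inequality r < s is strict because <| is not reflexive: f <| f says that f is monotone.
    Positions count from 1, like ranks. *)
Lemma op_tri_chain N l (x : nat -> op N) :
  (forall r, 0 < r < l -> op_tri (x r) (x r.+1)) ->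
  forall r s, 0 < r < s -> s <= l -> op_tri (x r) (x s).
Proof.
move=> x_tri r; elim=> [|s IHs] rs sl; first by lia.
have [->|ne] := eqVneq r s; first by apply: x_tri; lia.
by apply: (@op_tri_trans _ _ (x s)); [apply: IHs; lia | apply: x_tri; lia].
Qed.

Section Fold.
Variables (N c : nat) (e : nat -> op N).
Hypothesis e_tri : forall r s, 0 < r < s -> s <= c -> op_tri (e r) (e s).

Definition folded r : op N := op_meet (e r) (dual (e (c.+1 - r))).

(** The reflection of r to c + 1 - r reverses positions and duality reverses <|, so the second
    factors ascend along with the first. *)
Lemma folded_tri r s : 0 < r < s -> s <= uphalf c ->
  op_tri (folded r) (folded s).
Proof.
by move=> rs sc; apply: op_tri_meet; last apply: dual_tri; apply: e_tri; lia.
Qed.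

(** Before the middle, position r strictly precedes its reflection. For odd c the middle is its own
    reflection, where only reflexivity of <= is available; hence <= at the end of A_k against <| in
    B_k. *)
Lemma folded_le r : 0 < r <= uphalf c -> op_le (folded r) (dual (folded r)).
Proof.
move=> rc; apply: meet_dual_le.
have [<-|ne] := eqVneq r (c.+1 - r); first exact: op_le_refl.
by apply: op_tri_le; apply: e_tri; lia.
Qed.

Lemma folded_even_tri : ~~ odd c -> 0 < c ->
  op_tri (folded (uphalf c)) (dual (folded (uphalf c))).
Proof. by move=> ce c0; apply: meet_dual_tri; apply: e_tri; lia. Qed.

End Fold.

Section Unfold.
Variables (N c : nat) (x : nat -> op N).
Let l := uphalf c.
Hypothesis x_tri : forall r, 0 < r < l -> op_tri (x r) (x r.+1).
Hypothesis x_le : op_le (x l) (dual (x l)).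
Hypothesis x_even : ~~ odd c -> 0 < c -> op_tri (x l) (dual (x l)).

Let unfold_chain r s : 0 < r < s -> s <= l -> op_tri (x r) (x s).
Proof. exact: op_tri_chain. Qed.

Let x_le_top r : 0 < r <= l -> op_le (x r) (x l).
Proof.
move=> rl; have [->|ne] := eqVneq r l; first exact: op_le_refl.
by apply: op_tri_le; apply: unfold_chain; lia.
Qed.

(** The way leads up to x_l, across x_l <= x_l^d and down to x_s^d. One strict climb makes the
    composite a <|, since <| absorbs <= on either side. If r = s = l, the bound forces c to be even
    and [x_even] applies. *)
Lemma unfold_cross r s : 0 < r <= l -> 0 < s <= l -> r + s <= c ->
  op_tri (x r) (dual (x s)).
Proof.
move=> rl sl rsc.
have key p q : 0 < p < l -> 0 < q <= l -> op_tri (x p) (dual (x q)).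
  move=> pl ql; apply: (@op_tri_le_trans _ _ (x l)).
    by apply: unfold_chain; lia.
  by apply: op_le_trans x_le _; apply: dual_le; apply: x_le_top; lia.
have [rl'|lr] := ltnP r l; first by apply: key; lia.
have [sl'|ls] := ltnP s l; first by apply: op_tri_dual; apply: key; lia.
have [-> ->] : r = l /\ s = l by lia.
by apply: x_even; lia.
Qed.

(** For even positive c both x_l and x_l^d occur, at positions l and l + 1; for odd c only x_l
    occurs, in the middle. *)
Definition unfolded r : op N :=
  if r <= l then x r else dual (x (c.+1 - r)).

Lemma unfolded_tri r s : 0 < r < s -> s <= c ->
  op_tri (unfolded r) (unfolded s).
Proof.
move=> rs sc; rewrite /unfolded; case: leqP => rl; case: leqP => sl.
- exact: unfold_chain.
- by apply: unfold_cross; lia.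
- by lia.
- by apply: dual_tri; apply: unfold_chain; lia.
Qed.

Lemma unfolded_cross r s : 0 < r -> 0 < s -> r + s <= c ->
  op_tri (unfolded r) (dual (unfolded s)).
Proof.
move=> r0 s0 rsc; rewrite /unfolded; case: leqP => rl; case: leqP => sl.
- by apply: unfold_cross; lia.
- by rewrite dualK; apply: unfold_chain; lia.
- by apply: dual_tri; apply: unfold_chain; lia.
- by lia.
Qed.

(** The bound on [r] forces [r < l], so the dual half of the chain is not reached. *)
Lemma unfolded_top r : 0 < r -> r.*2.+1 <= c -> op_tri (unfolded r) (x l).
Proof.
by move=> r0 rc; rewrite /unfolded ifT; [apply: unfold_chain; lia | lia].
Qed.

End Unfold.

(** * Descriptions without monotone symbols *)

Section NonMonotone.
Variables (n m : nat) (D : description (n + m)).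
Hypothesis redD : reduced D.
Hypothesis nomon : forall x, ~~ monotone D x.
Let c := chr D.
Let l := uphalf c.

(** Sending f_i to position rank(f_i) works because each kind of constraint gives the matching
    bound: ranks increase along f_i <| f_j, sum to at most c for f_i <| f_j^d, and satisfy 2
    rank(f_i) + 1 <= c for f_i <| g_j. Component [u] is the image of all g_j; [inord r.-1] turns
    positions from 1 into indices from 0. *)
Lemma unfolded_hom k (M : minion k.+1) (u : 'I_k.+1) :
  (forall N (h : optuple k.+1 N), mem_minion M h ->
    let x r := h (inord r.-1) in
    [/\ forall r, 0 < r < l -> op_tri (x r) (x r.+1),
        op_le (x l) (dual (x l)),
        ~~ odd c -> 0 < c -> op_tri (x l) (dual (x l))
      & 0 < m -> h u = dual (h u) /\ op_le (x l) (h u)]) ->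
  exists phi, minion_hom M (Clo D) phi.
Proof.
move=> MP; pose X r : term k.+1 := Var (inord r.-1).
pose T r := if r <= l then X r else Dual (X (c.+1 - r)).
apply: (@hom_to_Clo _ _ _ redD _ _ (fun i => T (rank D i)) (Var u)) => N h Mh.
have [xt xl xe xu] := MP N h Mh; set x := (fun r => h (inord r.-1))
  in xt xl xe xu.
have eT r : eval h (T r) = unfolded c x r by rewrite /T /unfolded; case: ifP.
split=> [i j ij|i j ij|j|i j ij|j mj]; rewrite ?eT.
- apply: unfolded_tri; rewrite ?rank_le_chr //.
  by rewrite (rank_gt0 redD nomon) (rank_edge redD nomon).
- by apply: unfolded_cross; rewrite ?(rank_gt0 redD nomon) //;
    apply: rank_dual_le_chr.
- by case: xu => //; apply: leq_ltn_trans (ltn_ord j).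
- have [_] := xu (leq_ltn_trans (leq0n j) (ltn_ord j)); apply: op_tri_le_trans.
  apply: unfolded_top => //; first exact: (rank_gt0 redD nomon).
  exact: (rank_selfdual_le_chr ij).
- by have := nomon (gs n j); rewrite mj.
Qed.

Definition lit_term k (x : literal k) : term k :=
  if x.2 then Dual (Var x.1) else Var x.1.

Lemma eval_lit_term k N (h : optuple k N) x : eval h (lit_term x) = lit_val h x.
Proof. by case: x => i []. Qed.

(** The terms are chosen before [h], from [D] alone, so that they define a homomorphism. The third
    clause also covers l = 0, which the second excludes. *)
Lemma folded_terms : exists Y : nat -> term (n + m),
  forall N (h : optuple (n + m) N), in_Clo D h ->
  [/\ forall r s, 0 < r < s -> s <= l -> op_tri (eval h (Y r)) (eval h (Y s)),
      forall r, 0 < r <= l -> op_le (eval h (Y r)) (dual (eval h (Y r))),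
      op_le (eval h (Y l)) (dual (eval h (Y l)))
    & ~~ odd c -> 0 < c -> op_tri (eval h (Y l)) (dual (eval h (Y l)))].
Proof.
have [d ds dc] := chr_chain redD nomon; have [nm0 _ _ _] := redD.
pose x0 : literal (n + m) := sym (Ordinal nm0).
pose E r := lit_term (nth x0 d r.-1).
exists (fun r => Meet (E r) (Dual (E (c.+1 - r)))) => N h hD.
have E_tri r s : 0 < r < s -> s <= c -> op_tri (eval h (E r)) (eval h (E s)).
  apply: (@op_tri_chain _ _ (fun r => eval h (E r))) => {r s} r rc.
  rewrite !eval_lit_term; apply: derives_sound hD.
  move/(sortedP x0): ds => /(_ r.-1); rewrite dc prednK; first by apply; lia.
  by lia.
split=> [r s rs sl|r rl||ce c0].
- exact: (folded_tri E_tri).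
- exact: (folded_le E_tri).
(* With c = 0 the chain is empty, and [Y l] is the default literal [x0] met with its own dual. *)
- have [c0|c0] := posnP c; last by apply: (folded_le E_tri); lia.
  have d0 : d = [::] by apply: size0nil; rewrite dc.
  by apply: meet_dual_le; rewrite /E d0 !nth_nil; apply: op_le_refl.
- exact: (folded_even_tri E_tri).
Qed.

Lemma hom_to_A : exists phi, minion_hom (Clo D) (minionA l) phi.
Proof.
have [Y YP] := folded_terms; apply: (@term_hom _ _ _ _ (fun i => Y i.+1)).
move=> N h hD; have [Yt Yle Yl Ye] := YP N h hD.
split=> [|i j ij|i il]; first exact: in_I_eval_tuple (minion_idem hD).
  by rewrite !ffunE; apply: Yt; have := ltn_ord j; lia.
by rewrite !ffunE il.
Qed.

Lemma hom_to_B : 0 < c -> ~~ odd c ->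
  exists phi, minion_hom (Clo D) (minionB l) phi.
Proof.
move=> c0 ce.
have [Y YP] := folded_terms; apply: (@term_hom _ _ _ _ (fun i => Y i.+1)).
move=> N h hD; have [Yt Yle Yl Ye] := YP N h hD.
split=> [|i j ij|i il]; first exact: in_I_eval_tuple (minion_idem hD).
  by rewrite !ffunE; apply: Yt; have := ltn_ord j; lia.
by rewrite !ffunE il; apply: Ye.
Qed.

Definition clamp_term k (g p : term k) : term k := Meet (Join g p) (Dual p).

Lemma hom_to_C : 0 < m -> ~~ odd c ->
  exists phi, minion_hom (Clo D) (minionC l.+1) phi.
Proof.
move=> m0 ce; pose g := Var (gs n (Ordinal m0)).
have [Y YP] := folded_terms.
(* The self-dual entry follows the l folded terms. *)
pose t (i : 'I_l.+1) := if i < l then Y i.+1 else clamp_term g (Y l).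
apply: (@term_hom _ _ _ _ t) => N h hD; have [Yt Yle Yl Ye] := YP N h hD.
have gd := selfdual_gs redD (Ordinal m0) hD.
split=> [|i j ij jl|i j ij jl|i il|i il]; rewrite ?ffunE.
- exact: in_I_eval_tuple (minion_idem hD).
- by rewrite /t !ifT; [apply: Yt; lia | lia | lia].
- rewrite /t ifT; last by lia.
  rewrite ifF; last by lia.
  have -> : i.+1 = l by lia.
  exact: le_op_clamp.
- by rewrite /t ifF; [apply: op_clamp_selfdual | lia].
- rewrite /t ifT; last by lia.
  have il' : i.+1 = l by lia.
  by rewrite il'; apply: Ye => //; lia.
Qed.

Lemma hom_to_D : 0 < m -> exists phi, minion_hom (Clo D) (minionD l) phi.
Proof.
move=> m0; pose g := Var (gs n (Ordinal m0)).
have [Y YP] := folded_terms.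
(* Here the self-dual entry replaces the last folded term; as it lies above that term, <| from the
   preceding entry is preserved. *)
pose t (i : 'I_l) := if i.+1 < l then Y i.+1 else clamp_term g (Y l).
apply: (@term_hom _ _ _ _ t) => N h hD; have [Yt Yle Yl Ye] := YP N h hD.
have gd := selfdual_gs redD (Ordinal m0) hD.
split=> [|i j ij|i il]; rewrite ?ffunE.
- exact: in_I_eval_tuple (minion_idem hD).
- have jl := ltn_ord j; rewrite /t ifT; last by lia.
  case: ifP => jl'; first by apply: Yt; lia.
  by apply: op_tri_le_trans (le_op_clamp _ Yl); apply: Yt; lia.
- by rewrite /t ifF; [apply: op_clamp_selfdual | lia].
Qed.

Lemma hom_from_A : m = 0 -> odd c ->
  exists phi, minion_hom (minionA l) (Clo D) phi.
Proof.
move=> m0 co; have := @unfolded_hom; rewrite -/l.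
(* An odd c makes l positive, which gives the nonempty index set that [inord] needs. *)
have : 0 < l by lia.
case El : l => [//|k] _ /(_ k (minionA k.+1) ord0); apply=> N h [_ h1 h2] x.
rewrite m0; split=> [r rl||ce|//].
- by apply: h1; rewrite !inordK; lia.
- by apply: h2; rewrite inordK.
- by rewrite co in ce.
Qed.

Lemma hom_from_B : m = 0 -> 0 < c -> ~~ odd c ->
  exists phi, minion_hom (minionB l) (Clo D) phi.
Proof.
move=> m0 c0 ce; have := @unfolded_hom; rewrite -/l.
have : 0 < l by lia.
case El : l => [//|k] _ /(_ k (minionB k.+1) ord0); apply=> N h [_ h1 h2] x.
rewrite m0; split=> [r rl||_ _|//].
- by apply: h1; rewrite !inordK; lia.
- by apply: op_tri_le; apply: h2; rewrite inordK.
- by apply: h2; rewrite inordK.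
Qed.

Lemma hom_from_C : ~~ odd c ->
  exists phi, minion_hom (minionC l.+1) (Clo D) phi.
Proof.
move=> ce; apply: (@unfolded_hom _ _ ord_max) => N h [_ h1 h2 h3 h4] x.
have h3m : h ord_max = dual (h ord_max) by apply: h3.
(* If l = 0, then c = 0 and the tuple consists of the self-dual component alone; [x 0] denotes it
   because [0.-1] is 0. *)
have [l0|l0] := posnP l.
  have -> : x l = h ord_max.
    by congr (h _); apply: val_inj; rewrite /= inordK; lia.
  split=> [r rl||_ c0|_]; [by lia | | by lia | by split=> //; apply: op_le_refl].
  by rewrite -h3m; apply: op_le_refl.
have h4l : op_tri (x l) (dual (x l)) by apply: h4; rewrite inordK; lia.
split=> // [r rl||_]; first by apply: h1; rewrite !inordK; lia.
- exact: op_tri_le.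
- by split=> //; apply: h2; rewrite ?inordK //=; lia.
Qed.

(** The self-dual h_l serves both as the middle entry of the unfolded chain and as the image of
    every g_j. *)
Lemma hom_from_D : odd c ->
  exists phi, minion_hom (minionD l) (Clo D) phi.
Proof.
move=> co; have := @unfolded_hom; rewrite -/l.
have : 0 < l by lia.
case El : l => [//|k] _ /(_ k (minionD k.+1) ord_max); apply=> N h [_ h1 h2] x.
have xm : x k.+1 = h ord_max.
  by congr (h _); apply: val_inj; rewrite /= inordK.
have h2m : h ord_max = dual (h ord_max) by apply: h2.
rewrite xm -h2m; split=> [r rl||ce|_].
- by apply: h1; rewrite !inordK; lia.
- exact: op_le_refl.
- by rewrite co in ce.
- by split=> //; apply: op_le_refl.
Qed.

End NonMonotone.

(** * Descriptions with a monotone symbol *)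

Section Monotone.
Variables (n m : nat) (D : description (n + m)).
Hypothesis redD : reduced D.

(** With every f_i sent to h, each constraint becomes h <| h or h <| h^d. *)
Lemma hom_from_Binf : m = 0 -> exists phi, minion_hom minionBinf (Clo D) phi.
Proof.
move=> m0; apply: (@hom_to_Clo _ _ _ redD _ _ (fun=> Var ord0) (Var ord0)).
have no (j : 'I_m) : False by have := ltn_ord j; lia.
by move=> N h [_ h1 h2]; split=> // [j|j]; case: (no j).
Qed.

(** Constraints f_i <| f_j^d hold because h_1 <| h_2 = h_2^d <| h_1^d. *)
Lemma hom_from_Cinf : (forall j : 'I_m, ~~ monotone D (gs n j)) ->
  exists phi, minion_hom minionCinf (Clo D) phi.
Proof.
move=> gnm; apply: (@hom_to_Clo _ _ _ redD _ _ (fun=> Var ord0) (Var ord_max)).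
move=> N h [_ h1 h2 h3]; split=> //= [_ _ _|j mj].
  by apply: op_tri_trans (h2) _; rewrite h3; apply: dual_tri.
by have := gnm j; rewrite mj.
Qed.

Lemma hom_from_Dinf : exists phi, minion_hom minionDinf (Clo D) phi.
Proof.
apply: (@hom_to_Clo _ _ _ redD _ _ (fun=> Var ord0) (Var ord0)).
by move=> N h [_ h1 h2]; split=> //= _ _ _; rewrite -h2.
Qed.

Definition core_term i : term (n + m) :=
  Meet (Var (fs m i)) (Dual (Var (fs m i))).

(** Monotonicity passes to duals and meets; the second relation is p <= f <| f <= p^d. *)
Lemma core_term_spec i N (h : optuple (n + m) N) :
  monotone D (fs m i) -> in_Clo D h ->
  let p := eval h (core_term i) in op_tri p p /\ op_tri p (dual p).
Proof.
move=> mi [_ /(_ _ mi) hi]; split; last exact: meet_dual_tri.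
by apply: op_tri_meet => //; apply: dual_tri.
Qed.

Lemma hom_to_Binf i : monotone D (fs m i) ->
  exists phi, minion_hom (Clo D) minionBinf phi.
Proof.
move=> mi; apply: (@term_hom _ _ _ _ (fun=> core_term i)) => N h hD.
have [pp pd] := core_term_spec mi hD.
by split; rewrite ?ffunE //; apply: in_I_eval_tuple (minion_idem hD).
Qed.

Lemma hom_to_Cinf i (j : 'I_m) : monotone D (fs m i) ->
  exists phi, minion_hom (Clo D) minionCinf phi.
Proof.
move=> mi; pose t (x : 'I_2) :=
  if x == ord0 then core_term i else clamp_term (Var (gs n j)) (core_term i).
apply: (@term_hom _ _ _ _ t) => N h hD.
have [pp /op_tri_le pd] := core_term_spec mi hD.
split; rewrite ?ffunE //.
- exact: in_I_eval_tuple (minion_idem hD).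
- exact: op_tri_le_trans pp (le_op_clamp _ pd).
- exact: op_clamp_selfdual (selfdual_gs redD j hD) pd.
Qed.

Lemma hom_to_Dinf j : monotone D (gs n j) ->
  exists phi, minion_hom (Clo D) minionDinf phi.
Proof.
move=> mj; apply: (@term_hom _ _ _ _ (fun=> Var (gs n j))) => N h hD.
split; rewrite ?ffunE; first exact: in_I_eval_tuple (minion_idem hD).
- by have [_ /(_ _ mj)] := hD.
- exact: selfdual_gs hD.
Qed.

End Monotone.

(** * Assembly of the seven equivalences *)

Theorem theorem4p14 (n m : nat) (D : description (n + m)) (redD : reduced D) :
  ((forall s : 'I_(n + m), ~~ monotone D s) ->
    let l := uphalf (chr D) in
    [/\ m = 0 -> odd (chr D) -> minion_equiv (Clo D) (minionA l),
        m = 0 -> ~~ odd (chr D) -> minion_equiv (Clo D) (minionB l),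
        0 < m -> ~~ odd (chr D) -> minion_equiv (Clo D) (minionC l.+1)
      & 0 < m -> odd (chr D) -> minion_equiv (Clo D) (minionD l)])
  /\
  ((exists s : 'I_(n + m), monotone D s) ->
    [/\ m = 0 -> minion_equiv (Clo D) minionBinf,
        0 < m -> (forall j : 'I_m, ~~ monotone D (gs n j)) ->
          minion_equiv (Clo D) minionCinf
      & 0 < m -> (exists j : 'I_m, monotone D (gs n j)) ->
          minion_equiv (Clo D) minionDinf]).
Proof.
split=> [nomon l|[s ms]]; split.
- by move=> m0 co; split; [apply: hom_to_A | apply: hom_from_A].
(* Without g's there is some f_i, and its rank is positive, so c = 0 cannot occur. *)
- move=> m0 ce; have c0 : 0 < chr D.
    have [nm0 _ _ _] := redD; have n0 : 0 < n by lia.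
    apply: leq_trans (rank_le_chr D (Ordinal n0)).
    exact: (rank_gt0 redD nomon).
  by split; [apply: hom_to_B | apply: hom_from_B].
- by move=> m0 ce; split; [apply: hom_to_C | apply: hom_from_C].
- by move=> m0 co; split; [apply: hom_to_D | apply: hom_from_D].
- move=> m0; split; last exact: hom_from_Binf.
  case: (splitP s) => i si; last by have := ltn_ord i; lia.
  by apply: (@hom_to_Binf _ _ _ i); rewrite -(_ : s = fs m i) //; apply: val_inj.
- move=> m0 gnm; split; last exact: hom_from_Cinf.
  (* The monotone symbol must be an f, since no g is monotone. *)
  case: (splitP s) => i si.
    apply: (@hom_to_Cinf _ _ _ redD i (Ordinal m0)).
    by rewrite -(_ : s = fs m i) //; apply: val_inj.
  by have := gnm i; rewrite -(_ : s = gs n i) ?ms //; apply: val_inj.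
- move=> m0 [j mj]; split; last exact: hom_from_Dinf.
  exact: (hom_to_Dinf redD mj).
Qed.
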